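(* Let $\psi\colon\mathbb{N}\to\mathbb{R}^+$ be a positive function satisfying $\sum_{n=1}^{\infty}\frac{n}{\psi(n)}<\infty$, and let $\mathfrak{M}$ be a subset of $\mathbb{N}^{\mathbb{N}}$ such that every sequence $(a_n)_{n=1}^\infty$ in $\mathfrak{M}$ satisfies $a_n\geq\psi(n)$ for all sufficiently large $n$. Then $$\dim_H\left\{x\in(0,1]\colon (p_n(x))_{n=1}^\infty\in\mathfrak{M}\right\}=\dim_H\left\{x\in(0,1]\colon (p'_n(x)-n+1)_{n=1}^\infty\in\mathfrak{M}\right\},$$ where $p_n(x)$ and $p'_n(x)$ denote the $n$th digits of the classical and of the modified Engel expansion of $x$, respectively, and $\dim_H$ is the Hausdorff dimension.
   Context: $\mathbb{N}=\{1,2,3,\dots\}$. Classical Engel expansion: every $x\in(0,1]$ has a unique representation $$x=\frac{1}{p_1}+\frac{1}{p_1p_2}+\frac{1}{p_1p_2p_3}+\cdots$$ as an infinite series, with natural numbers $p_1\ge2$ and $p_{n+1}\ge p_n$ for all $n$; put $p_n(x)=p_n$. Modified Engel expansion: every $x\in(0,1]$ has a unique representation $$x=\frac{1}{p'_1}+\frac{1}{(p'_1-1)p'_2}+\frac{1}{(p'_1-1)(p'_2-1)p'_3}+\cdots$$ as an infinite series, with natural numbers $p'_1\ge2$ and $p'_{n+1}\ge p'_n+1$ for all $n$; put $p'_n(x)=p'_n$. *)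

(* Defs.v *)
From mathcomp Require Import all_boot all_order all_algebra.
From mathcomp Require Import all_classical all_reals all_analysis.

Set Implicit Arguments.
Unset Strict Implicit.
Unset Printing Implicit Defensive.

Import Order.TTheory GRing.Theory Num.Theory.
Import numFieldNormedType.Exports.

Local Open Scope classical_set_scope.
Local Open Scope ring_scope.

Section hausdorff_dimension.
Context {R : realType}.
Local Open Scope ereal_scope.

(* -oo on the empty set, so the empty set satisfies every diameter bound. *)
Definition diameter (A : set R) : \bar R :=
  ereal_sup [set `|z.1 - z.2|%:E | z in A `*` A].

(* diam(A)^s, where the empty set counts for 0 and a point for 0^0 = 1 when
   s = 0, so that the 0-dimensional Hausdorff measure is the counting measure. *)
Definition diameter_pow (s : R) (A : set R) : \bar R :=
  if A == set0 then 0 else diameter A `^ s.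

(* Finite covers are included, by padding with empty sets. *)
Definition hausdorff_premeasure (s delta : R) (A : set R) : \bar R :=
  ereal_inf [set \sum_(i <oo) diameter_pow s (U i) |
    U in [set U : nat -> set R | A `<=` \bigcup_i U i /\
                                 forall i, diameter (U i) <= delta%:E]].

Definition hausdorff_measure (s : R) (A : set R) : \bar R :=
  ereal_sup [set hausdorff_premeasure s delta A |
    delta in [set delta : R | (0 < delta)%R]].

Definition hausdorff_dim (A : set R) : \bar R :=
  ereal_inf [set s%:E | s in [set s : R | (0 <= s)%R /\
                                          hausdorff_measure s A = 0]].

End hausdorff_dimension.

(* Sequences (a_n)_{n >= 1} are represented with indices shifted by one:
   p n stands for the (n+1)-st term. *)
Section engel.
Context {R : realType}.

Definition engel_expansion (x : R) (p : nat -> nat) : Prop :=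
  [/\ (2 <= p 0)%N, forall n, (p n <= p n.+1)%N &
      series (fun n => (\prod_(i < n.+1) (p i)%:R)^-1 : R) @ \oo --> x].

Definition modified_engel_expansion (x : R) (p : nat -> nat) : Prop :=
  [/\ (2 <= p 0)%N, forall n, (p n + 1 <= p n.+1)%N &
      series (fun n => ((\prod_(i < n) ((p i)%:R - 1)) * (p n)%:R)^-1 : R)
        @ \oo --> x].

(* The digit sequences, which exist and are unique for x in (0, 1]. *)
Definition engel_digit (x : R) : nat -> nat :=
  get [set p | engel_expansion x p].

Definition modified_engel_digit (x : R) : nat -> nat :=
  get [set p | modified_engel_expansion x p].

End engel.

(* Main.v *)
Require Import Defs.
From mathcomp Require Import all_boot all_order all_algebra.
From mathcomp Require Import all_classical all_reals all_analysis.
From mathcomp Require Import ring lra zify.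
Import Order.TTheory GRing.Theory Num.Theory.
Import numFieldNormedType.Exports.
Local Open Scope classical_set_scope.
Local Open Scope ring_scope.

(** Let [a] be the sequence tested against [M].  Both sets of the theorem are
    images of one set [D] of nondecreasing sequences, the points with classical
    digits [a n], respectively with modified digits [a n + n] (indices from 0),
    because each expansion exists and is unique ([engel_value_surj],
    [engel_value_inj], [digit_set_image]).

    The map taking one image to the other is bi-Lipschitz on the pieces
    [tame L] of [D], on which the sums of [i / a i] are bounded by [L]
    ([engel_value_lipschitz]).  Indeed the denominators of the two series are
    products of [a i], respectively of [a i + i - 1], and the ratio of the
    second product to the first lies between 1/2 and [expR L].  This alone does
    not compare differences of values, which can be much smaller than the terms
    of the series: two points lie close to a common endpoint of neighbouring
    cylinders when the digits of the smaller one grow as slowly as admissible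
    for a long time and the next digit of the larger one is huge.  The
    difference is therefore rewritten, in [series_difference], as a sum of
    nonnegative terms measuring the distances of both points to such an
    endpoint; each of these terms changes by a bounded factor when one expansion
    is replaced by the other.

    Since [a n >= psi n.+1] eventually and the sum of [n / psi n] is finite,
    [D] is the union of its countably many tame pieces with [L] integral
    ([tame_of_summable]).  Countable unions and Lipschitz images preserve null
    sets of the [s]-dimensional Hausdorff measure, so the two images are null
    for the same [s], which determines their dimensions. *)

(** * Null sets of Hausdorff measures *)

Lemma diameter_pow_ge0 {R : realType} (s : R) (A : set R) :
  (0 <= diameter_pow s A)%E.
Proof. by rewrite /diameter_pow; case: ifP => // _; exact: poweR_ge0. Qed.

Lemma diameter_ge0 {R : realType} (A : set R) : A !=set0 ->
  (0 <= diameter A)%E.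
Proof.
move=> [x Ax]; apply: ereal_sup_ubound; exists (x, x) => //=.
by rewrite subrr normr0.
Qed.

(** The non-emptiness guard on the diameter bound is forced by the diameter of
    the empty set being -oo.  At [s = 0] both sides count non-empty sets. *)
Lemma diameter_pow_expand {R : realType} (s K : R) (A B : set R) : 0 <= s ->
    0 < K -> (A !=set0 -> B !=set0) ->
    (A !=set0 -> diameter A <= K%:E * diameter B)%E ->
  (diameter_pow s A <= (K `^ s)%:E * diameter_pow s B)%E.
Proof.
move=> s0 K0 AB dAB; rewrite {1}/diameter_pow; case: eqP => [_|/eqP/set0P A0].
  by rewrite mule_ge0 ?lee_fin ?powR_ge0 ?diameter_pow_ge0.
have B0 := AB A0; rewrite /diameter_pow; case: eqP => [B_|_].
  by rewrite B_ in B0; case: B0.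
rewrite -poweR_EFin -poweRM ?lee_fin ?diameter_ge0 ?(ltW K0)//.
by apply: gt0_ler_poweR => //; rewrite ?in_itv/= ?leey ?andbT ?mule_ge0
  ?diameter_ge0 ?lee_fin ?(ltW K0)//; exact: dAB.
Qed.

(** Every argument about dimension below happens at the level of null sets,
    for which the supremum over [delta] and the infimum over covers reduce to
    the existence of arbitrarily fine and arbitrarily cheap covers. *)
Lemma hausdorff_measure0P {R : realType} (s : R) (A : set R) :
  hausdorff_measure s A = 0%E <->
  forall delta e : R, 0 < delta -> 0 < e -> exists U : nat -> set R,
    [/\ A `<=` \bigcup_i U i, forall i, (diameter (U i) <= delta%:E)%E &
        (\sum_(i <oo) diameter_pow s (U i) <= e%:E)%E].
Proof.
split=> [A0 delta e d0 e0|H].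
  have pre0 : (hausdorff_premeasure s delta A < e%:E)%E.
    apply: (@le_lt_trans _ _ 0%E); last by rewrite lte_fin.
    by rewrite -A0; apply: ereal_sup_ubound; exists delta.
  have [_ [U [AU dU] <-] Ue] := ereal_inf_lt pre0.
  by exists U; split => //; exact: ltW.
apply/eqP; rewrite eq_le; apply/andP; split.
  apply: ge_ereal_sup => _ [delta d0 <-]; apply/lee_addgt0Pr => e e0.
  have [U [AU dU Ue]] := H _ _ d0 e0.
  rewrite add0e; apply: le_trans Ue; apply: ereal_inf_lbound.
  by exists U.
apply: (@le_trans _ _ (hausdorff_premeasure s 1 A)).
  apply: le_ereal_inf_tmp => _ [U _ <-].
  by apply: nneseries_ge0 => n _ _; exact: diameter_pow_ge0.
by apply: ereal_sup_ubound; exists 1 => //=.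
Qed.

Lemma hausdorff_null_subset {R : realType} (s : R) (A B : set R) :
  A `<=` B -> hausdorff_measure s B = 0%E -> hausdorff_measure s A = 0%E.
Proof.
move=> AB /hausdorff_measure0P B0; apply/hausdorff_measure0P => delta e d0 e0.
have [U [BU dU Ue]] := B0 _ _ d0 e0.
by exists U; split => //; exact: subset_trans BU.
Qed.

(** The n-th set gets a cover of cost [e / 2 ^ n.+1]; a bijection between nat
    and nat * nat turns these covers into a single sequence. *)
Lemma hausdorff_null_bigcup {R : realType} (s : R) (A : nat -> set R) :
  (forall n, hausdorff_measure s (A n) = 0%E) ->
  hausdorff_measure s (\bigcup_n A n) = 0%E.
Proof.
move=> A0; apply/hausdorff_measure0P => delta e d0 e0.
pose en n : R := e / (2 ^ n.+1)%:R.
have /choice[U UP] n : exists U : nat -> set R,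
    [/\ A n `<=` \bigcup_i U i, forall i, (diameter (U i) <= delta%:E)%E &
        (\sum_(i <oo) diameter_pow s (U i) <= (en n)%:E)%E].
  by apply/(hausdorff_measure0P s (A n)).1 => //;
    rewrite divr_gt0 ?ltr0n ?expn_gt0.
have /ppcard_eqP[f] := card_esym card_nat2.
exists (fun i => U (f i).1 (f i).2); split=> [x [n _ Anx]|i|].
- have [AU _ _] := UP n; have [k _ Ukx] := AU _ Anx.
  by exists (f^-1%FUN (n, k)) => //=; rewrite invK ?inE.
- by have [_ + _] := UP (f i).1; exact.
rewrite nneseries_esumT; last by move=> n; exact: diameter_pow_ge0.
rewrite -(reindex_esum setT setT f
  (fun z => diameter_pow s (U z.1 z.2))) //=.
have -> : [set: nat * nat] = [set: nat] `*`` (fun=> [set: nat]).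
  by apply/seteqP; split.
rewrite -(esum_esum (a := fun i j => diameter_pow s (U i j))); last first.
  by move=> *; exact: diameter_pow_ge0.
rewrite -nneseries_esumT; last first.
  by move=> n; apply: esum_ge0 => *; exact: diameter_pow_ge0.
apply: (@le_trans _ _ (\sum_(0 <= i <oo) (0 + (en i)%:E))%E).
  apply: lee_nneseries => [n _ _|n _].
    by apply: esum_ge0 => *; exact: diameter_pow_ge0.
  rewrite add0e -nneseries_esumT; last by move=> ?; exact: diameter_pow_ge0.
  by have [_ _] := UP n.
apply: le_trans (epsilon_trick _ _ (ltW e0)) _ => //.
by rewrite eseries0 ?add0e.
Qed.

(** The Lipschitz map is the correspondence [f a |-> g a] between two
    parametrizations over [D].  Phrasing it this way avoids choosing a preimage
    of a point of [f @` D]. *)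
Lemma hausdorff_null_lipschitz {R : realType} {T : Type} (s K : R)
    (f g : T -> R) (D : set T) : 0 <= s -> 0 < K ->
    (forall a b, D a -> D b -> `|g a - g b| <= K * `|f a - f b|) ->
  hausdorff_measure s (f @` D) = 0%E -> hausdorff_measure s (g @` D) = 0%E.
Proof.
move=> s0 K0 fgK /hausdorff_measure0P fD; apply/hausdorff_measure0P.
move=> delta e d0 e0; have Ks := powR_gt0 s K0.
have [U [fU dU Ue]] := fD _ _ (divr_gt0 d0 K0) (divr_gt0 e0 Ks).
pose V i := g @` (D `&` f @^-1` U i).
have VU i : V i !=set0 -> U i !=set0 by move=> [_ [a [_ Ua] _]]; exists (f a).
have dV i : V i !=set0 -> (diameter (V i) <= K%:E * diameter (U i))%E.
  move=> Vi; apply: ge_ereal_sup => _ [[_ _] [/= [a [Da Ua] <-] [b [Db Ub] <-]] <-].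
  apply: (@le_trans _ _ (K * `|f a - f b|)%:E); first by rewrite lee_fin fgK.
  rewrite EFinM lee_pmul2l ?lte_fin //.
  by apply: ereal_sup_ubound; exists (f a, f b).
exists V; split=> [_ [a Da <-]|i|].
- have [i _ Ui] := fU (f a) (ex_intro2 _ _ a Da erefl).
  by exists i => //; exists a.
- have [/dV dVi|/set0P/negP] := pselect (V i !=set0); last first.
    rewrite negbK => /eqP ->.
    by apply: ge_ereal_sup => _ [z [[]]].
  apply: le_trans dVi _.
  by rewrite muleC -lee_pdivlMr // -EFinM.
apply: (@le_trans _ _ (\sum_(i <oo) (K `^ s)%:E * diameter_pow s (U i))%E).
  apply: lee_nneseries => [n _ _|n _]; first exact: diameter_pow_ge0.
  exact: diameter_pow_expand (VU n) (dV n).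
rewrite nneseriesZl; last by move=> *; exact: diameter_pow_ge0.
by rewrite muleC -lee_pdivlMr // -EFinM.
Qed.

(** * Engel expansions with a shift *)

(** The classical ([d = false]) and the modified ([d = true]) expansions are the
    two members of one family: digits satisfy [p n + d <= p n.+1] and the n-th
    term is the inverse of [(p 0 - d) ... (p n.-1 - d) * p n].  The only algebra
    the theory needs is [gap_split], which holds because [d * d = d]. *)
Definition admissible (d : bool) (p : nat -> nat) : Prop :=
  (2 <= p 0)%N /\ forall n, (p n + d <= p n.+1)%N.

Definition weight (R : realType) (d : bool) (p : nat -> nat) (n : nat) : R :=
  \prod_(i < n) ((p i)%:R - d%:R).

Definition engel_term (R : realType) (d : bool) (p : nat -> nat) (n : nat) : R :=
  (weight R d p n * (p n)%:R)^-1.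

Lemma admissible_ge d p n : admissible d p -> (2 + d * n <= p n)%N.
Proof.
move=> [p0 pS]; elim: n => [|n IH]; first by rewrite muln0.
by have := pS n; rewrite mulnS; lia.
Qed.

Lemma admissible_ge2 {R : realType} d p n : admissible d p ->
  2 <= (p n)%:R :> R.
Proof. by move=> /(admissible_ge _ _ n) pn; rewrite (ler_nat R 2); lia. Qed.

Lemma natr_bool_itv {R : realType} (d : bool) : 0 <= d%:R :> R /\ d%:R <= 1 :> R.
Proof. by rewrite ler0n (ler_nat R _ 1) leq_b1. Qed.

Lemma weightS {R : realType} d p n :
  weight R d p n.+1 = weight R d p n * ((p n)%:R - d%:R).
Proof. by rewrite /weight big_ord_recr. Qed.

Lemma weight_gt0 {R : realType} d p n : admissible d p -> 0 < weight R d p n.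
Proof.
move=> pd; apply: prodr_gt0 => i _.
by have := @admissible_ge2 R _ _ i pd; have := @natr_bool_itv R d; lra.
Qed.

Lemma engel_term_gt0 {R : realType} d p n : admissible d p ->
  0 < engel_term R d p n.
Proof.
move=> pd; rewrite invr_gt0 mulr_gt0 ?weight_gt0//.
by have := @admissible_ge2 R _ _ n pd; lra.
Qed.

(** [1 / (x - 1)] is the value of the largest tail whose first digit is [x]; the
    identity says that removing [1 / x] from it and rescaling by [x - d] leaves
    the largest tail whose first digit is [x + d], the least digit that may
    follow [x]. *)
Lemma gap_split {R : realType} (d : bool) (x : R) : 2 <= x ->
  (x - 1)^-1 - x^-1 = ((x - d%:R) * (x + d%:R - 1))^-1.
Proof.
move=> x2; have x0 : x != 0 by rewrite gt_eqF//; lra.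
have x1 : x - 1 != 0 by rewrite gt_eqF//; lra.
by case: d => /=; field; rewrite ?addrK ?x0 ?x1.
Qed.

(** If a digit [p n] is followed by [p n.+1] instead of the least possible
    [p n + d], the largest possible tail drops from [1 / (p n + d - 1)] to
    [1 / (p n.+1 - 1)]; this is that drop, on the scale of the expansion and
    over a common denominator. *)
Definition gap_term (R : realType) (d : bool) (p : nat -> nat) (n : nat) : R :=
  (p n.+1 - (p n + d))%:R /
  (weight R d p n.+1 * ((p n)%:R + d%:R - 1) * ((p n.+1)%:R - 1)).

(** What is still missing when the expansion is cut after [p n]: the largest
    tail that may follow. *)
Definition gap_remainder (R : realType) (d : bool) (p : nat -> nat) (n : nat) : R :=
  (weight R d p n.+1 * ((p n)%:R + d%:R - 1))^-1.

(** The distance from a partial sum to the largest sum with the same digits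
    before [n] and the same [p n] is thus written with nonnegative terms only. *)
Lemma gap_telescope {R : realType} d p n k : admissible d p -> (n <= k)%N ->
  (weight R d p n * ((p n)%:R - 1))^-1 - \sum_(n <= m < k.+1) engel_term R d p m
  = \sum_(n <= m < k) gap_term R d p m + gap_remainder R d p k.
Proof.
move=> pd; have p2 m := @admissible_ge2 R _ _ m pd.
have [d0 d1] := @natr_bool_itv R d.
have last m : (weight R d p m * ((p m)%:R - 1))^-1 - engel_term R d p m =
    gap_remainder R d p m.
  rewrite /gap_remainder /engel_term weightS -mulrA [in RHS]invfM -gap_split//.
  by rewrite [RHS]mulrBr -!invfM.
have step m : gap_remainder R d p m =
    gap_term R d p m + (weight R d p m.+1 * ((p m.+1)%:R - 1))^-1.
  rewrite /gap_remainder /gap_term natrB ?pd.2// natrD.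
  have W0 := @weight_gt0 R _ _ m.+1 pd.
  have := p2 m; have := p2 m.+1.
  move: (weight _ _ _ _) (p m)%:R (p m.+1)%:R d%:R d0 d1 W0 => w x y c c0 c1 w0 y2 x2.
  have y1 : y - 1 != 0 by rewrite gt_eqF//; lra.
  have x1 : x + c - 1 != 0 by rewrite gt_eqF//; lra.
  by field; rewrite ?x1 ?y1 gt_eqF.
elim: k => [|k IH].
  by rewrite leqn0 => /eqP ->; rewrite big_nat1 big_geq// add0r last.
rewrite leq_eqVlt => /predU1P[<-|]; first by rewrite big_nat1 big_geq// add0r last.
rewrite ltnS => nk; rewrite big_nat_recr 1?leqW//= opprD addrA IH// [RHS]addrC.
by rewrite [in RHS]big_nat_recr//= -(last k.+1) (step k); ring.
Qed.

Lemma gap_term_ge0 {R : realType} d p n : admissible d p -> 0 <= gap_term R d p n.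
Proof.
move=> pd; have p2 m := @admissible_ge2 R _ _ m pd.
have [d0 d1] := @natr_bool_itv R d.
apply: divr_ge0; rewrite ?ler0n// !mulr_ge0 ?(ltW (@weight_gt0 R _ _ _ pd))//.
  by have := p2 n; lra.
by have := p2 n.+1; lra.
Qed.

Lemma gap_remainder_ge0 {R : realType} d p n : admissible d p ->
  0 <= gap_remainder R d p n.
Proof.
move=> pd; have := @admissible_ge2 R _ _ n pd; have [d0 d1] := @natr_bool_itv R d.
move=> p2; rewrite invr_ge0 mulr_ge0 ?(ltW (@weight_gt0 R _ _ _ pd))//; lra.
Qed.

Lemma engel_series_le {R : realType} d p n : admissible d p ->
  series (engel_term R d p) n <= ((p 0)%:R - 1)^-1.
Proof.
move=> pd; apply: (@le_trans _ _ (series (engel_term R d p) n.+1)).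
  rewrite seriesS lerDr; exact/ltW/engel_term_gt0.
have := gap_telescope (R := R) _ _ _ _ pd (leq0n n).
rewrite /weight big_ord0 mul1r => /eqP; rewrite subr_eq => /eqP ->.
rewrite lerDr addr_ge0 ?gap_remainder_ge0// sumr_ge0// => m _.
exact: gap_term_ge0.
Qed.

Definition engel_value (R : realType) (d : bool) (p : nat -> nat) : R :=
  limn (series (engel_term R d p)).

Lemma engel_cvg {R : realType} d p : admissible d p ->
  series (engel_term R d p) @ \oo --> engel_value R d p.
Proof.
move=> pd; apply: nondecreasing_is_cvgn.
  by apply: nondecreasing_series => n _ _; exact/ltW/engel_term_gt0.
by exists ((p 0)%:R - 1)^-1 => _ [n _ <-]; exact: engel_series_le.
Qed.

Lemma engel_value_itv {R : realType} d p : admissible d p ->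
  engel_value R d p \in `]0, 1].
Proof.
move=> pd; rewrite in_itv/=; have cv := @engel_cvg R _ _ pd.
have p2 := @admissible_ge2 R _ _ 0 pd.
apply/andP; split.
  apply: (@lt_le_trans _ _ (series (engel_term R d p) 1)).
    by rewrite /series/= big_nat1 engel_term_gt0.
  apply: nondecreasing_cvgn_le => //.
  by apply: nondecreasing_series => n _ _; exact/ltW/engel_term_gt0.
apply: (@le_trans _ _ ((p 0)%:R - 1)^-1); last first.
  by rewrite invf_le1; lra.
by apply: limr_le => //; apply: nearW => n; exact: engel_series_le.
Qed.

(** Two expansions which part at index [n] are separated by the right endpoint
    [1 / (q n - 1)] of the tails starting with [q n]: the part of the first
    series beyond index [n], the distance from [1 / p n] to that endpoint, and
    the distance from the endpoint to the second series.  No cancellation is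
    left, so a comparison of the individual terms is enough to compare the
    differences of the two kinds of expansions. *)
Lemma series_difference {R : realType} d p q n k :
    admissible d p -> admissible d q -> (forall i, (i < n)%N -> p i = q i) ->
    (p n < q n)%N -> (n <= k)%N ->
  series (engel_term R d p) k.+1 - series (engel_term R d q) k.+1 =
  \sum_(n.+1 <= m < k.+1) engel_term R d p m +
  (q n - (p n).+1)%:R / (weight R d p n * (p n)%:R * ((q n)%:R - 1)) +
  (\sum_(n <= m < k) gap_term R d q m + gap_remainder R d q k).
Proof.
move=> pd qd pq pqn nk; rewrite -gap_telescope// /series/=.
have wpq m : (m <= n)%N -> weight R d q m = weight R d p m.
  move=> mn; apply: eq_bigr => i _; rewrite pq//; exact: leq_trans mn.
rewrite (big_cat_nat _ (n := n))//= 1?leqW//.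
rewrite [X in _ - X](big_cat_nat _ (n := n))//= 1?leqW//.
have -> : \sum_(0 <= i < n) engel_term R d q i = \sum_(0 <= i < n) engel_term R d p i.
  apply: eq_big_nat => i /= ni.
  by rewrite /engel_term pq// wpq// ltnW.
rewrite (big_ltn (m := n) (F := engel_term R d p)) ?ltnS//.
rewrite wpq// {2}/engel_term natrB// -natr1.
have := @weight_gt0 R _ _ n pd; have := @admissible_ge2 R _ _ n pd.
have := @admissible_ge2 R _ _ n qd.
move: (weight _ _ _ _) (p n)%:R (q n)%:R => w x y y2 x2 w0.
have y1 : y - 1 != 0 by rewrite gt_eqF//; lra.
have x1 : x != 0 by rewrite gt_eqF//; lra.
move: (\sum_(_ <= _ < _) _) (\sum_(_ <= _ < _) _) (\sum_(_ <= _ < _) _) => s1 s2 s3.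
by field; rewrite ?x1 ?y1 gt_eqF.
Qed.

(** * Bounded distortion between the two expansions *)

(** The digit sequence of kind [d] attached to a nondecreasing sequence [a]; with
    indices from 0, [a n = p' n - n] is the sequence tested in the modified
    case. *)
Definition shifted (d : bool) (a : nat -> nat) (n : nat) : nat := (a n + d * n)%N.

(** Sequences along which the ratios between modified and classical weights,
    products of factors [1 + (i - 1) / a i], are bounded by [expR L]. *)
Definition tame {R : realType} (L : R) (a : nat -> nat) : Prop :=
  admissible false a /\ forall n, \sum_(0 <= i < n) i%:R / (a i)%:R <= L.

Lemma admissible_shifted d a : admissible false a -> admissible d (shifted d a).
Proof.
move=> [a0 aS]; split=> [|n]; rewrite /shifted; first by rewrite muln0 addn0.
by have := aS n; rewrite mulnS; lia.
Qed.

Lemma shiftedE {R : realType} d a n :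
  (shifted d a n)%:R = (a n)%:R + d%:R * n%:R :> R.
Proof. by rewrite natrD natrM. Qed.

Lemma tame_index_le {R : realType} (L : R) a n : tame L a ->
  0 <= L /\ n%:R <= L * (a n)%:R.
Proof.
move=> [aa aL]; split; first by have := aL 0; rewrite big_geq.
have a2 := @admissible_ge2 R _ _ n aa.
rewrite -ler_pdivrMr; last by lra.
apply: le_trans (aL n.+1); rewrite big_nat_recr//= lerDr.
by apply: sumr_ge0 => i _; rewrite divr_ge0.
Qed.

Lemma weight_shift_le {R : realType} (L : R) a n : tame L a ->
  weight R true (shifted true a) n <= expR L * weight R false (shifted false a) n.
Proof.
move=> aL; apply: (@le_trans _ _ (expR (\sum_(0 <= i < n) i%:R / (a i)%:R)
    * weight R false (shifted false a) n)); last first.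
  apply: ler_wpM2r; first exact/ltW/weight_gt0/admissible_shifted/aL.1.
  by rewrite ler_expR; exact: aL.2.
elim: n => [|n IH]; first by rewrite /weight !big_ord0 big_geq// expR0 mulr1.
rewrite !weightS big_nat_recr//= expRD mulrACA.
have w0 := @weight_gt0 R _ _ n (admissible_shifted true _ aL.1).
have a2 := @admissible_ge2 R _ _ n aL.1.
apply: ler_pM => //; first exact: ltW.
  by rewrite shiftedE /=; have := ler0n R n; lra.
rewrite !shiftedE /= mul0r mul1r addr0 subr0 -ler_pdivrMr; last by lra.
apply: le_trans (expR_ge1Dx _).
by rewrite ler_pdivrMr ?mulrDl ?divfK ?mul1r ?gt_eqF//; lra.
Qed.

(** Only the factor of index 0 decreases, from [a 0] to [a 0 - 1], hence by at
    most one half. *)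
Lemma weight_unshift_le {R : realType} a n : admissible false a ->
  weight R false (shifted false a) n <= 2 * weight R true (shifted true a) n.
Proof.
move=> aa; have a2 m := @admissible_ge2 R _ _ m aa.
case: n => [|n]; first by rewrite /weight !big_ord0; lra.
elim: n => [|n IH].
  rewrite /weight !big_ord1 !shiftedE /=; have := a2 0; lra.
rewrite weightS [in leRHS]weightS mulrA.
have w0 := @weight_gt0 R _ _ n.+1 (admissible_shifted false _ aa).
apply: ler_pM => //; rewrite ?(ltW w0)// !shiftedE /=.
  by have := a2 n.+1; lra.
by rewrite -natr1; have := ler0n R n; lra.
Qed.

Lemma weight_comparable {R : realType} (L : R) d e a n : tame L a ->
  weight R d (shifted d a) n <= 2 * expR L * weight R e (shifted e a) n.
Proof.
move=> aL; have [L0 _] := tame_index_le _ _ 0 aL.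
have e1 : 1 <= expR L by rewrite -expR0 ler_expR.
have w0 c := @weight_gt0 R _ _ n (admissible_shifted c _ aL.1).
have := weight_shift_le _ _ n aL; have := @weight_unshift_le R _ n aL.1.
by have := w0 false; have := w0 true; move: d e => [] []; nra.
Qed.

(** Every factor that occurs in a difference of expansions besides the weights,
    that is [p n], [p n - 1] or [p n + d - 1] for either kind, lies in this
    range. *)
Definition digit_like {R : realType} (a : nat -> nat) (n : nat) (x : R) : bool :=
  (a n)%:R - 1 <= x <= (a n)%:R + n%:R.

(** [a n + n <= (2 + 2 * L) * (a n - 1)], since [n <= L * a n] and
    [a n <= 2 * (a n - 1)]. *)
Lemma digit_like_comparable {R : realType} (L x y : R) a n : tame L a ->
  digit_like a n x -> digit_like a n y -> y <= (2 + 2 * L) * x.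
Proof.
move=> aL /andP[x1 _] /andP[_ y2]; have [L0 nL] := tame_index_le _ _ n aL.
by have a2 := @admissible_ge2 R _ _ n aL.1; nra.
Qed.

Lemma digit_like_gt0 {R : realType} (x : R) a n : admissible false a ->
  digit_like a n x -> 0 < x.
Proof.
by move=> aa /andP[x1 _]; have a2 := @admissible_ge2 R _ _ n aa; lra.
Qed.

Lemma digit_like_shifted {R : realType} d a n : admissible false a ->
  [/\ digit_like a n ((shifted d a n)%:R : R),
      digit_like a n ((shifted d a n)%:R - 1 : R) &
      digit_like a n ((shifted d a n)%:R + d%:R - 1 : R)].
Proof.
move=> aa; rewrite /digit_like shiftedE; have := ler0n R n.
by case: d => /=; split; apply/andP; split; lra.
Qed.

(** One weight and at most two digit-like factors. *)
Definition distortion {R : realType} (L : R) : R :=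
  2 * expR L * ((2 + 2 * L) * (2 + 2 * L)).

Lemma ler_inv_scale {R : realType} (C u v : R) : 0 < u -> 0 < v ->
  v <= C * u -> u^-1 <= C * v^-1.
Proof. by move=> u0 v0 vu; rewrite ler_pdivlMr// mulrC ler_pdivrMr. Qed.

Lemma denominator_comparable {R : realType} {L x y x' y' : R} {d e a b c i n m} :
    tame L a -> tame L b -> tame L c ->
    digit_like a n x -> digit_like a n x' ->
    digit_like b m y -> digit_like b m y' ->
  (weight R d (shifted d c) i * x * y)^-1 <=
  distortion L * (weight R e (shifted e c) i * x' * y')^-1.
Proof.
move=> aL bL cL ax ax' by_ by_'.
have w0 c' := @weight_gt0 R _ _ i (admissible_shifted c' _ cL.1).
have := w0 d; have := w0 e; have := weight_comparable _ e d _ i cL.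
have := digit_like_comparable _ _ _ _ _ aL ax ax'.
have := digit_like_comparable _ _ _ _ _ bL by_ by_'.
have := digit_like_gt0 _ _ _ aL.1 ax; have := digit_like_gt0 _ _ _ aL.1 ax'.
have := digit_like_gt0 _ _ _ bL.1 by_; have := digit_like_gt0 _ _ _ bL.1 by_'.
move: (weight R d _ _) (weight R e _ _) => w v.
move=> yp' yp xp' xp yy xx vw v0 ww0; apply: ler_inv_scale; rewrite ?mulr_gt0//.
rewrite /distortion.
have -> : 2 * expR L * ((2 + 2 * L) * (2 + 2 * L)) * (w * x * y) =
  (2 * expR L * w) * ((2 + 2 * L) * x) * ((2 + 2 * L) * y) by ring.
by rewrite !ler_pM ?mulr_ge0// ltW.
Qed.

Lemma distortion_gt0 {R : realType} (L : R) : 0 <= L -> 0 < distortion L.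
Proof. by move=> L0; rewrite /distortion !mulr_gt0 ?expR_gt0//; lra. Qed.

(** The case of a single digit-like factor, by inserting the same second factor
    on both sides. *)
Lemma pair_comparable {R : realType} {L x x' : R} {d e a c i n} :
    tame L a -> tame L c -> digit_like a n x -> digit_like a n x' ->
  (weight R d (shifted d c) i * x)^-1 <=
  distortion L * (weight R e (shifted e c) i * x')^-1.
Proof.
move=> aL cL ax ax'.
have := denominator_comparable (d := d) (e := e) (i := i) aL aL cL ax ax' ax ax.
have xp := digit_like_gt0 _ _ _ aL.1 ax.
rewrite [in leLHS]invfM [in leRHS]invfM mulrA ler_pM2r// invr_gt0 //.
Qed.

Lemma tail_comparable {R : realType} (L : R) d e a m : tame L a ->
  engel_term R d (shifted d a) m <= distortion L * engel_term R e (shifted e a) m.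
Proof.
move=> aL; have [dx _ _] := @digit_like_shifted R d _ m aL.1.
have [ex _ _] := @digit_like_shifted R e _ m aL.1.
exact: (pair_comparable aL aL dx ex).
Qed.

(** The numerator is [a m.+1 - a m] for both kinds: the shift of the digits
    compensates the stricter growth condition. *)
Lemma gap_term_comparable {R : realType} (L : R) d e a m : tame L a ->
  gap_term R d (shifted d a) m <= distortion L * gap_term R e (shifted e a) m.
Proof.
move=> aL; rewrite /gap_term.
have num c : (shifted c a m.+1 - (shifted c a m + c) = a m.+1 - a m)%N.
  by rewrite /shifted mulnS; lia.
rewrite !num mulrCA; apply: ler_wpM2l => //.
have [_ dx dz] := @digit_like_shifted R d _ m aL.1.
have [_ ex ez] := @digit_like_shifted R e _ m aL.1.
have [_ dy _] := @digit_like_shifted R d _ m.+1 aL.1.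
have [_ ey _] := @digit_like_shifted R e _ m.+1 aL.1.
exact: (denominator_comparable aL aL aL dz ez dy ey).
Qed.

Lemma gap_remainder_comparable {R : realType} (L : R) d e a m : tame L a ->
  gap_remainder R d (shifted d a) m <=
  distortion L * gap_remainder R e (shifted e a) m.
Proof.
move=> aL; have [_ _ dx] := @digit_like_shifted R d _ m aL.1.
have [_ _ ex] := @digit_like_shifted R e _ m aL.1.
exact: (pair_comparable aL aL dx ex).
Qed.

Lemma series_difference_comparable {R : realType} (L : R) d e a b n k :
    tame L a -> tame L b -> (forall i, (i < n)%N -> a i = b i) ->
    (a n < b n)%N -> (n <= k)%N ->
  series (engel_term R d (shifted d a)) k.+1 -
    series (engel_term R d (shifted d b)) k.+1 <=
  distortion L * (series (engel_term R e (shifted e a)) k.+1 -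
    series (engel_term R e (shifted e b)) k.+1).
Proof.
move=> aL bL ab abn nk.
have eqab c i : (i < n)%N -> shifted c a i = shifted c b i.
  by move=> /ab; rewrite /shifted => ->.
have ltab c : (shifted c a n < shifted c b n)%N by rewrite /shifted ltn_add2r.
have split_sum c := @series_difference R _ _ _ _ _
  (admissible_shifted c _ aL.1) (admissible_shifted c _ bL.1) (eqab c) (ltab c) nk.
rewrite !split_sum.
rewrite 3!(mulrDr (distortion L)) !lerD//.
- rewrite mulr_sumr ler_sum// => m _; exact: tail_comparable.
- have num c : (shifted c b n - (shifted c a n).+1 = b n - (a n).+1)%N.
    by rewrite /shifted; lia.
  rewrite !num mulrCA; apply: ler_wpM2l => //.
  have [dx _ _] := @digit_like_shifted R d _ n aL.1.
  have [ex _ _] := @digit_like_shifted R e _ n aL.1.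
  have [_ dy _] := @digit_like_shifted R d _ n bL.1.
  have [_ ey _] := @digit_like_shifted R e _ n bL.1.
  exact: (denominator_comparable aL bL aL dx ex dy ey).
- rewrite mulr_sumr ler_sum// => m _; exact: gap_term_comparable.
- exact: gap_remainder_comparable.
Qed.

Lemma first_difference (a b : nat -> nat) : a <> b ->
  exists2 n, (forall i, (i < n)%N -> a i = b i) & a n != b n.
Proof.
move=> ab; have exn : exists n, a n != b n.
  apply: contrapT => /forallNP H; apply: ab; apply/funext => n.
  by apply: contrapT => /eqP; exact: H.
have [n abn nmin] := ex_minnP exn; exists n => // i ni.
by apply/eqP; apply: contraTT ni => /nmin; rewrite -leqNgt.
Qed.

(** By [series_difference], the two values differ by at least the term of index
    [n.+1] of the series of [p]. *)
Lemma engel_value_lt {R : realType} d p q n : admissible d p -> admissible d q ->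
    (forall i, (i < n)%N -> p i = q i) -> (p n < q n)%N ->
  engel_value R d q < engel_value R d p.
Proof.
move=> pd qd pq pqn; rewrite -subr_gt0.
apply: (@lt_le_trans _ _ (engel_term R d p n.+1)); first exact: engel_term_gt0.
apply: (cvgr_to_ge (cvgB (@engel_cvg R _ _ pd) (@engel_cvg R _ _ qd))).
exists n.+2 => //= -[|k] //= nk.
have {}nk : (n < k)%N by [].
rewrite fctE (series_difference _ _ _ _ _ pd qd pq pqn (ltnW nk)).
have q2 := @admissible_ge2 R _ _ n qd.
have p2 := @admissible_ge2 R _ _ n pd.
rewrite big_ltn// -!addrA lerDl !addr_ge0//.
- by apply: sumr_ge0 => i _; exact/ltW/engel_term_gt0.
- apply: divr_ge0 => //; rewrite !mulr_ge0 ?(ltW (@weight_gt0 R _ _ _ pd))//; lra.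
- by apply: sumr_ge0 => i _; exact: gap_term_ge0.
- exact: gap_remainder_ge0.
Qed.

Lemma engel_value_inj {R : realType} d p q : admissible d p -> admissible d q ->
  engel_value R d p = engel_value R d q -> p = q.
Proof.
move=> pd qd vpq; apply: contrapT => /first_difference[n pq].
rewrite neq_ltn => /orP[] pqn.
  by have := @engel_value_lt R _ _ _ _ pd qd pq pqn; rewrite vpq ltxx.
have qp i : (i < n)%N -> q i = p i by move=> /pq.
by have := @engel_value_lt R _ _ _ _ qd pd qp pqn; rewrite vpq ltxx.
Qed.

(** As [d] and [e] are arbitrary, this is a bi-Lipschitz bound. *)
Lemma engel_value_lipschitz {R : realType} (L : R) d e a b :
    tame L a -> tame L b ->
  `|engel_value R d (shifted d a) - engel_value R d (shifted d b)| <=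
  distortion L *
    `|engel_value R e (shifted e a) - engel_value R e (shifted e b)|.
Proof.
move=> aL bL; have [->|/first_difference[n ab abn]] := pselect (a = b).
  by rewrite !subrr !normr0 mulr0.
wlog abn' : a b aL bL ab abn / (a n < b n)%N.
  move=> H; have := abn; rewrite neq_ltn => /orP[|ban]; first exact: H.
  rewrite distrC [X in _ * X]distrC.
  by apply: H => //; [move=> i /ab | rewrite eq_sym].
have adm c := (admissible_shifted c _ aL.1, admissible_shifted c _ bL.1).
have lt c : engel_value R c (shifted c b) < engel_value R c (shifted c a).
  apply: (@engel_value_lt R c _ _ n (adm c).1 (adm c).2).
    by move=> i /ab; rewrite /shifted => ->.
  by rewrite /shifted ltn_add2r.
rewrite !gtr0_norm ?subr_gt0//.
have cv c : series (engel_term R c (shifted c a)) k -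
    series (engel_term R c (shifted c b)) k @[k --> \oo] -->
    engel_value R c (shifted c a) - engel_value R c (shifted c b).
  exact: cvgB (@engel_cvg R _ _ (adm c).1) (@engel_cvg R _ _ (adm c).2).
apply: (ler_cvg_to (cv d) (cvgM (cvg_cst (distortion L)) (cv e))).
exists n.+1 => // -[|k] //= nk.
exact: (series_difference_comparable _ _ _ _ _ n k aL bL ab abn' nk).
Qed.

(** * Existence of expansions *)

(** The only [p] with [1 / p < t <= 1 / (p - 1)]. *)
Definition next_digit {R : realType} (t : R) : nat := (Num.trunc t^-1).+1.

Lemma next_digitP {R : realType} (t : R) : 0 < t <= 1 ->
  [/\ (2 <= next_digit t)%N, (next_digit t)%:R^-1 < t &
      t <= ((next_digit t)%:R - 1)^-1].
Proof.
move=> /andP[t0 t1]; have ti : 1 <= t^-1 by rewrite invf_ge1.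
have [] := andP (truncn_itv (le_trans ler01 ti)); rewrite /next_digit => le lt.
have p2 : (0 < Num.trunc t^-1)%N by rewrite truncn_gt0.
split=> //.
  by rewrite invf_plt ?posrE.
by rewrite -natr1 addrK -[leLHS]invrK lef_pV2 ?posrE ?ltr0n// invr_gt0.
Qed.

(** The tail following the first digit [p] of [t], obtained by solving
    [t = 1 / p + t' / (p - d)] for [t']. *)
Definition remainder_step {R : realType} (d : bool) (t : R) : R :=
  (t - (next_digit t)%:R^-1) * ((next_digit t)%:R - d%:R).

Lemma remainder_step_itv {R : realType} d (t : R) : 0 < t <= 1 ->
  0 < remainder_step d t <= ((next_digit t)%:R + d%:R - 1)^-1.
Proof.
move=> t01; have [p2 pt tp] := next_digitP _ t01.
have {}p2 : 2 <= (next_digit t)%:R :> R by rewrite (ler_nat R 2).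
have [d0 d1] := @natr_bool_itv R d.
rewrite /remainder_step mulr_gt0 ?subr_gt0//=; last by lra.
rewrite -ler_pdivlMr; last by lra.
by rewrite -invfM mulrC -gap_split//; lra.
Qed.

Lemma remainder_step_itv01 {R : realType} d (t : R) : 0 < t <= 1 ->
  0 < remainder_step d t <= 1.
Proof.
move=> t01; have [p2 _ _] := next_digitP _ t01.
have {}p2 : 2 <= (next_digit t)%:R :> R by rewrite (ler_nat R 2).
have [d0 d1] := @natr_bool_itv R d.
have /andP[-> /le_trans->//] := remainder_step_itv d t t01.
by rewrite invf_le1; lra.
Qed.

Lemma next_digit_step {R : realType} (d : bool) (t : R) : 0 < t <= 1 ->
  (next_digit t + d <= next_digit (remainder_step d t))%N.
Proof.
move=> t01; have [p2 _ _] := next_digitP _ t01.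
have {}p2' : 2 <= (next_digit t)%:R :> R by rewrite (ler_nat R 2).
have [d0 d1] := @natr_bool_itv R d.
have /andP[s0 sp] := remainder_step_itv d t t01.
rewrite [leqRHS]/next_digit -(prednK (n := next_digit t + d)); last by lia.
rewrite ltnS truncn_ge_nat ?invr_ge0 ?(ltW s0)//.
rewrite -[leLHS]invrK lef_pV2 ?posrE//; last first.
  by rewrite invr_gt0 ltr0n; lia.
by rewrite -subn1 natrB ?natrD//; lia.
Qed.

(** The first factor equals 1 when [d = true] and [p 0 = 2]; all later ones are
    at least 2. *)
Lemma weight_ge_expn {R : realType} d p n : admissible d p ->
  2 ^+ n <= weight R d p n.+1.
Proof.
move=> pd; have [d0 d1] := @natr_bool_itv R d.
elim: n => [|n IH].
  by rewrite /weight big_ord1 expr0; have := @admissible_ge2 R _ _ 0 pd; lra.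
rewrite weightS exprSr; apply: ler_pM => //.
rewrite lerBrDr -natrD (ler_nat R).
by have := admissible_ge _ _ n.+1 pd; case: d {pd IH d0 d1} => /=; lia.
Qed.

(** Greedy algorithm: the remainder after [n] digits is a number of ]0, 1]
    divided by a weight, so it tends to 0. *)
Lemma engel_value_surj {R : realType} d (x : R) : x \in `]0, 1] ->
  exists2 p, admissible d p & engel_value R d p = x.
Proof.
rewrite in_itv/= => x01.
pose t n := iter n (remainder_step d) x; pose p n := next_digit (t n).
have t01 n : 0 < t n <= 1 by elim: n => // n; exact: remainder_step_itv01.
have pd : admissible d p.
  split=> [|n]; first by have [] := next_digitP _ (t01 0).
  exact: next_digit_step (t01 n).
have xE n : x = series (engel_term R d p) n + (weight R d p n)^-1 * t n.
  elim: n => [|n IH].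
    by rewrite /series/= big_geq// /weight big_ord0 invr1 mul1r add0r.
  have tS : t n.+1 = (t n - (p n)%:R^-1) * ((p n)%:R - d%:R) by [].
  rewrite {1}IH seriesS weightS tS {2}/engel_term.
  have := @weight_gt0 R _ _ n pd; have := @admissible_ge2 R _ _ n pd.
  have [d0 d1] := @natr_bool_itv R d.
  move: (weight _ _ _ _) (p n)%:R (t n) (d%:R) d0 d1 => w y u c c0 c1 y2 w0.
  have y0 : y != 0 by rewrite gt_eqF//; lra.
  have yc : y - c != 0 by rewrite gt_eqF//; lra.
  by field; rewrite ?y0 ?yc gt_eqF.
have cv := @engel_cvg R _ _ pd.
exists p => //; apply/eqP; rewrite eq_le; apply/andP; split.
  apply: (cvgr_to_le cv); apply: nearW => n.
  by rewrite [leRHS](xE n) lerDl mulr_ge0 ?invr_ge0 ?(ltW (@weight_gt0 R _ _ _ pd))//;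
    have /andP[/ltW] := t01 n.
have hv : engel_value R d p + 2^-1 ^+ n @[n --> \oo] --> engel_value R d p + 0.
  apply: cvgD; first exact: cvg_cst.
  by apply: cvg_expr; rewrite ger0_norm; lra.
rewrite -[leRHS]addr0; apply: (cvgr_to_ge hv); apply: nearW => n.
rewrite [leLHS](xE n.+1) lerD//.
  apply: nondecreasing_cvgn_le; last exact: cv.
  by apply: nondecreasing_series => m _ _; exact/ltW/engel_term_gt0.
have /andP[tn0 tn1] := t01 n.+1.
rewrite exprVn -[leRHS]mulr1; apply: ler_pM => //; rewrite ?invr_ge0 ?(ltW tn0)//.
  exact/ltW/weight_gt0.
by rewrite lef_pV2 ?posrE ?exprn_gt0 ?weight_gt0// weight_ge_expn.
Qed.

Definition family_digit (R : realType) (d : bool) (x : R) : nat -> nat :=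
  get [set p | admissible d p /\ engel_value R d p = x].

Lemma family_digit_value {R : realType} d p : admissible d p ->
  family_digit R d (engel_value R d p) = p.
Proof.
move=> pd; have [] := getPex (ex_intro
  (fun q => admissible d q /\ engel_value R d q = engel_value R d p) p (conj pd erefl)).
by move=> qd; exact: engel_value_inj.
Qed.

Lemma series_engel_value {R : realType} d p (x : R) : admissible d p ->
  (series (engel_term R d p) @ \oo --> x) <-> engel_value R d p = x.
Proof.
move=> pd; split=> [cv|<-]; last exact: engel_cvg.
exact: (cvg_lim (@Rhausdorff R) cv).
Qed.

Lemma engel_digitE {R : realType} (x : R) : engel_digit x = family_digit R false x.
Proof.
rewrite /engel_digit /family_digit; congr get; apply/funext => p; apply/propext.
rewrite /engel_expansion/= [X in series X](_ : _ = engel_term R false p); last first.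
  apply/funext => n; rewrite /engel_term /weight big_ord_recr/=.
  by congr (_ * _)^-1; apply: eq_bigr => i _; rewrite subr0.
split=> [[p0 pS cv]|[pd px]].
  have pd : admissible false p by split=> // n; rewrite addn0.
  by split=> //; apply/series_engel_value.
split; [exact: pd.1| |exact/(series_engel_value _ _ _ pd)].
by move=> n; have := pd.2 n; rewrite addn0.
Qed.

Lemma modified_engel_digitE {R : realType} (x : R) :
  modified_engel_digit x = family_digit R true x.
Proof.
rewrite /modified_engel_digit /family_digit; congr get.
apply/funext => p; apply/propext; split=> [[p0 pS cv]|[pd px]].
  have pd : admissible true p by [].
  by split=> //; apply/series_engel_value.
split; [exact: pd.1|exact: pd.2|exact/(series_engel_value _ _ _ pd)].
Qed.

(** Existence of expansions gives one inclusion, uniqueness the other: it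
    identifies the chosen digits of the value of an expansion. *)
Lemma digit_set_image {R : realType} (d : bool) (M : set (nat -> nat)) :
  [set x : R | x \in `]0, 1] /\ M (fun n => (family_digit R d x n - d * n)%N)] =
  (fun a => engel_value R d (shifted d a)) @` [set a | admissible false a /\ M a].
Proof.
apply/seteqP; split=> [x [x01 Mx]|_ [a [aa Ma] <-]] /=.
  have [p pd px] := @engel_value_surj R d x x01.
  move: Mx; rewrite -px family_digit_value// => Mx.
  have pn n : (d * n <= p n)%N.
    by apply: leq_trans (admissible_ge _ _ n pd); exact: leq_addl.
  exists (fun n => (p n - d * n)%N).
    split=> //; split=> [|n]; first by rewrite muln0 subn0; exact: pd.1.
    by have := pd.2 n; have := pn n; rewrite mulnS; lia.
  by congr engel_value; apply/funext => n; rewrite /shifted subnK.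
have ad := admissible_shifted d _ aa.
split; first exact: engel_value_itv.
rewrite family_digit_value//; apply: (eq_rect _ M Ma).
by apply/funext => n; rewrite /shifted addnK.
Qed.

(** * Transfer of null sets *)

(** The sequences with a common bound [L] are handled by the Lipschitz estimate;
    these pieces are countably many. *)
Lemma hausdorff_null_transfer {R : realType} (s : R) d e (D : set (nat -> nat)) :
    0 <= s -> (forall a, D a -> exists L : nat, tame (L%:R : R) a) ->
  hausdorff_measure s ((fun a => engel_value R d (shifted d a)) @` D) = 0%E ->
  hausdorff_measure s ((fun a => engel_value R e (shifted e a)) @` D) = 0%E.
Proof.
move=> s0 Dtame D0.
pose DL (L : nat) := D `&` [set a | tame (L%:R : R) a].
apply: (@hausdorff_null_subset _ _ _
    (\bigcup_L ((fun a => engel_value R e (shifted e a)) @` DL L))).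
  by move=> _ [a Da <-]; have [L aL] := Dtame a Da; exists L => //; exists a.
apply: hausdorff_null_bigcup => L.
apply: (hausdorff_null_lipschitz s (distortion L%:R)
    (fun a => engel_value R d (shifted d a)) _ _ s0 (distortion_gt0 _ (ler0n _ _))).
  by move=> a b [_ aL] [_ bL]; exact: engel_value_lipschitz.
by apply: hausdorff_null_subset D0; apply: image_subset => a [].
Qed.

(** The finitely many indices at which [psi] does not bound [a] only enlarge
    the bound [L]. *)
Lemma tame_of_summable {R : realType} (psi : nat -> R) (a : nat -> nat) :
    (forall n, (0 < n)%N -> 0 < psi n) ->
    (\sum_(1 <= n <oo) (n%:R / psi n)%:E < +oo)%E ->
    admissible false a -> (\forall n \near \oo, psi n.+1 <= (a n)%:R) ->
  exists L : nat, tame (L%:R : R) a.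
Proof.
move=> psi0 psi_sum aa [N _ aN].
have f0 n : (1 <= n)%N -> 0 <= n%:R / psi n by move=> n1; rewrite divr_ge0// ltW// psi0.
have a0 n : 0 <= n%:R / (a n)%:R :> R by rewrite divr_ge0.
set S := (\sum_(1 <= n <oo) (n%:R / psi n)%:E)%E in psi_sum.
have S0 : (0 <= S)%E by apply: nneseries_ge0 => n n1 _; rewrite lee_fin f0.
have Sfin : S \is a fin_num by rewrite ge0_fin_numE.
have Sk k : \sum_(1 <= n < k) n%:R / psi n <= fine S.
  rewrite -lee_fin fineK// -sumEFin.
  by apply: nneseries_lim_ge => n n1 _; rewrite lee_fin f0.
pose s : R := \sum_(0 <= i < N) i%:R / (a i)%:R + fine S.
have s0 : 0 <= s by rewrite addr_ge0 ?fine_ge0// sumr_ge0.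
exists (Num.trunc s).+1; split=> // k.
apply: le_trans (ltW (truncnS_gt s)).
have [kN|Nk] := leqP k N.
  apply: (@le_trans _ _ (\sum_(0 <= i < N) i%:R / (a i)%:R)); last first.
    by rewrite lerDl fine_ge0.
  by rewrite [leRHS](big_cat_nat _ (n := k))//= lerDl sumr_ge0.
rewrite (big_cat_nat _ (n := N))//= 1?ltnW// lerD2l.
apply: le_trans (Sk k.+1).
rewrite [leRHS](big_cat_nat _ (n := N.+1))//= 1?ltnS 1?ltnW//.
rewrite -[leLHS]add0r lerD//.
  by rewrite big_nat_cond sumr_ge0// => n /andP[/andP[n1 _] _]; exact: f0.
rewrite big_add1/=; apply: ler_sum_nat => n /andP[Nn _].
have psin := psi0 n.+1 isT; have an := aN n Nn.
apply: ler_pM => //; first by rewrite ler_nat.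
by rewrite lef_pV2 ?posrE// (lt_le_trans psin).
Qed.

(* Terms of index n >= 1 are stored at position n - 1, so the (n+1)-st term of
   (p'_m(x) - m + 1)_m is p'_{n+1}(x) - (n+1) + 1; the natural-number
   subtraction is exact because p'_{n+1}(x) >= n + 2. *)
Theorem mainTheorem2 (R : realType) (psi : nat -> R) (M : set (nat -> nat))
    (psi_pos : forall n : nat, (0 < n)%N -> 0 < psi n)
    (psi_sum : (\sum_(1 <= n <oo) (n%:R / psi n)%:E < +oo)%E)
    (M_pos : forall a : nat -> nat, M a -> forall n : nat, (0 < a n)%N)
    (M_psi : forall a : nat -> nat, M a ->
      \forall n \near \oo, psi n.+1 <= (a n)%:R) :
  hausdorff_dim [set x : R | x \in `]0, 1] /\
    M (fun n : nat => engel_digit x n)] =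
  hausdorff_dim [set x : R | x \in `]0, 1] /\
    M (fun n : nat => (modified_engel_digit x n - n.+1 + 1)%N)].
Proof.
pose D := [set a | admissible false a /\ M a].
pose E d := (fun a => engel_value R d (shifted d a)) @` D.
have -> : [set x : R | x \in `]0, 1] /\ M (fun n => engel_digit x n)] = E false.
  rewrite /E /D -digit_set_image; apply/funext => x /=; rewrite engel_digitE.
  congr (_ /\ _); congr M; apply/funext => n.
  by rewrite mul0n subn0.
have -> : [set x : R | x \in `]0, 1] /\
    M (fun n => (modified_engel_digit x n - n.+1 + 1)%N)] = E true.
  rewrite /E /D -digit_set_image; apply/funext => x /=.
  rewrite modified_engel_digitE.
  (* Outside ]0, 1] both sides are false, and the truncated subtractions of the
     default digits need not agree. *)
  have [/(engel_value_surj true)[p pd <-]|x01] := boolP (x \in `]0, 1]); last first.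
    by apply/propext; split=> -[].
  rewrite family_digit_value//; congr (_ /\ _); congr M; apply/funext => n.
  by have := admissible_ge _ _ n pd; rewrite !mul1n; lia.
have D_tame a : D a -> exists L : nat, tame (L%:R : R) a.
  by move=> [aa Ma]; apply: tame_of_summable aa (M_psi a Ma).
congr ereal_inf; congr image; apply/seteqP; split=> s [s0 Es]; split=> //;
  exact: hausdorff_null_transfer Es.
Qed.
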